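(* Let $G=(V,E)$ be a finite directed graph (possibly cyclic) and consider a finite functional causal model on $G$. If the model is uniquely solvable, then it is averagely uniquely solvable.
   Context: Finite functional causal model on a directed graph $G=(V,E)$, $V$ finite, $E\subseteq V\times V$, $\mathrm{Pa}(v)=\{w:(w,v)\in E\}$: to each $v\in V$ assign a random variable with values $x_v$ in a non-empty finite set $\mathcal X_v$; an error variable with values $u_v$ in a finite set $\mathcal U_v$, with probability distribution $p^v$ on $\mathcal U_v$; and a function $f^v:\prod_{w\in \mathrm{Pa}(v)}\mathcal X_w\times\mathcal U_v\to\mathcal X_v$. For $u=\{u_v\in\mathcal U_v\}_{v\in V}$, the number of solutions is $N(u)=\sum_{x}\prod_{v\in V}\delta_{f^v(x_{\mathrm{Pa}(v)},u_v),x_v}$ (sum over all $x=\{x_v\in\mathcal X_v\}_{v\in V}$). The average number of solutions is $\overline N=\sum_u N(u)\prod_{v\in V}p^v(u_v)$. The model is uniquely solvable if $N(u)=1$ for all $u=\{u_v\in\mathcal U_v\}_{v\in V}$, and averagely uniquely solvable if $\overline N=1$. *)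

(* Defs.v *)
From HB Require Import structures.
From mathcomp Require Import all_boot all_order all_algebra.
From mathcomp Require Import reals.

Set Implicit Arguments.
Unset Strict Implicit.
Unset Printing Implicit Defensive.

Import Order.TTheory GRing.Theory Num.Theory.
Local Open Scope ring_scope.

(* A directed graph on the finite vertex set V is its edge relation E : rel V,
   with [E w v] meaning that (w, v) is an edge; loops and cycles are allowed. *)

Definition parent (V : finType) (E : rel V) (v : V) : finType :=
  {w : V | E w v}.

Definition parents_assignment (V : finType) (E : rel V) (X : V -> finType)
    (v : V) : finType :=
  {dffun forall w : parent E v, X (val w)}.

Definition parents_restr (V : finType) (E : rel V) (X : V -> finType)
    (x : {dffun forall v : V, X v}) (v : V) : parents_assignment E X v :=
  [ffun w : parent E v => x (val w)].

Definition is_distribution (R : realType) (T : finType) (p : T -> R) : Prop :=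
  (forall t : T, 0 <= p t) /\ \sum_(t : T) p t = 1.

Record functional_causal_model (R : realType) (V : finType) (E : rel V) :=
  FunctionalCausalModel {
    value : V -> finType;
    value_nonempty : forall v : V, (0 < #|value v|)%N;
    error : V -> finType;
    error_prob : forall v : V, error v -> R;
    error_probP : forall v : V, is_distribution (@error_prob v);
    mechanism : forall v : V,
      parents_assignment E value v -> error v -> value v
  }.

Definition values (R : realType) (V : finType) (E : rel V)
    (M : functional_causal_model R E) : finType :=
  {dffun forall v : V, value M v}.

Definition errors (R : realType) (V : finType) (E : rel V)
    (M : functional_causal_model R E) : finType :=
  {dffun forall v : V, error M v}.

(* The Kronecker delta is the boolean equality test, coerced to nat. *)
Definition num_solutions (R : realType) (V : finType) (E : rel V)
    (M : functional_causal_model R E) (u : errors M) : nat :=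
  (\sum_(x : values M)
     \prod_(v : V) (mechanism (parents_restr E x v) (u v) == x v))%N.

Definition average_num_solutions (R : realType) (V : finType) (E : rel V)
    (M : functional_causal_model R E) : R :=
  \sum_(u : errors M)
    (num_solutions u)%:R * \prod_(v : V) error_prob (u v).

Definition uniquely_solvable (R : realType) (V : finType) (E : rel V)
    (M : functional_causal_model R E) : Prop :=
  forall u : errors M, num_solutions u = 1%N.

Definition averagely_uniquely_solvable (R : realType) (V : finType)
    (E : rel V) (M : functional_causal_model R E) : Prop :=
  average_num_solutions M = 1.

(* Main.v *)
Require Import Defs.
From mathcomp Require Import all_boot all_order all_algebra.
From mathcomp Require Import reals.

Import GRing.Theory.
Local Open Scope ring_scope.

(** Once every solution count is 1, the average is the total mass of the product distribution on
    error configurations. Distributing the product over the sums, in the dependent form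
    [bigA_distr_big_dffun], factors this mass into the masses of the single [error_prob], each 1.
    Cycles do not interfere: errors are independent. *)

Lemma bigA_distr_big_dffun (R : comPzSemiRingType) (I : finType)
    (T : I -> finType) (F : forall i : I, T i -> R) :
  \prod_(i : I) \sum_(t : T i) F i t =
  \sum_(f : {dffun forall i : I, T i}) \prod_(i : I) F i (f i).
Proof.
rewrite (reindex (@dffun_of_fprod I T)); last exact/onW_bij/dffun_of_fprod_bij.
pose G i := [ffun t : T i => F i t].
transitivity (\sum_(f : fprod T) \prod_(i in I) G i (f i)); last first.
  by apply: eq_bigr => f _; apply: eq_bigr => i _; rewrite !ffunE.
(* A dependent function is a plain function into the disjoint union of the [T i] whose value at [i]
   has tag [i], so non-dependent distributivity applies; under that restriction [untag 0] never
   returns its default. *)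
rewrite big_fprod -(bigA_distr_big_dep _ (fun i => untag 0 (G i))).
apply: eq_bigr => i _; apply: etrans (big_tag (fun i => G i) i).
by apply: eq_bigr => t _; rewrite ffunE.
Qed.

Theorem proposition4 (R : realType) (V : finType) (E : rel V)
    (M : functional_causal_model R E) :
  uniquely_solvable M -> averagely_uniquely_solvable M.
Proof.
move=> solM; rewrite /averagely_uniquely_solvable /average_num_solutions.
under eq_bigr => u _ do rewrite solM mul1r.
(* The total mass becomes a product over vertices of sums of [error_prob]. *)
rewrite -bigA_distr_big_dffun big1 // => v _.
by have [] := error_probP M v.
Qed.
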